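(* Let $X$ be an ergodic (irreducible and aperiodic) discrete-time homogeneous Markov chain on a finite state space $\mathcal{X}$ with transition matrix $P$, stationary distribution $\pi=(\pi_i)_{i\in\mathcal{X}}$, fundamental matrix $F$, average hitting time $t^{av}$ and resistance distance $\Omega=(\Omega_{i,j})_{i,j\in\mathcal{X}}$. Let $(\lambda_i)_{i=2}^{|\mathcal{X}|}$ be the non-unit eigenvalues of $P$ (the eigenvalues other than $1$, listed with algebraic multiplicity). Then: (1) (Kirchhoff index) $$\sum_{i,j\in\mathcal{X}}\Omega_{i,j}=2|\mathcal{X}|\,t^{av}=2|\mathcal{X}|\sum_{i=2}^{|\mathcal{X}|}\frac{1}{1-\lambda_i}.$$ (2) (Multiplicative Kirchhoff index) Writing $M$ for the diagonal matrix with $M_{i,i}=\pi_i$ for all $i\in\mathcal{X}$, $$\sum_{i,j\in\mathcal{X}}\pi_i\pi_j\,\Omega_{i,j}=2\,\mathrm{Tr}(MF-M\Pi).$$ (3) (Additive Kirchhoff index) $$2t^{av}\le\sum_{i,j\in\mathcal{X}}(\pi_i+\pi_j)\,\Omega_{i,j}\le 2t^{av}(|\mathcal{X}|+1).$$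
   Context: $\Pi$ is the $|\mathcal{X}|\times|\mathcal{X}|$ matrix each of whose rows is $\pi$, and $I$ is the identity matrix of the same size. The fundamental matrix of $X$ is $F=(F_{i,j})_{i,j\in\mathcal X}:=(I-P+\Pi)^{-1}$ (the inverse always exists). The resistance distance of the Markov chain is $\Omega_{i,j}:=F_{i,i}+F_{j,j}-F_{i,j}-F_{j,i}$ for $i,j\in\mathcal{X}$. For $j\in\mathcal{X}$, $\tau_j:=\inf\{n\ge 0: X_n=j\}$ is the first hitting time of $j$, and $\mathbb{E}_i$ denotes expectation under $X_0=i$. The average hitting time is $t^{av}:=\sum_{i,j\in\mathcal{X}}\mathbb{E}_i(\tau_j)\,\pi_i\pi_j$. $\mathrm{Tr}$ denotes the trace. *)

(* Defs.v *)
From HB Require Import structures.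
From mathcomp Require Import all_boot all_order all_algebra.
From mathcomp Require Import complex.
From mathcomp Require Import all_classical all_reals all_analysis.

Set Implicit Arguments.
Unset Strict Implicit.
Unset Printing Implicit Defensive.

Import Order.TTheory GRing.Theory Num.Theory.

Local Open Scope classical_set_scope.
Local Open Scope ring_scope.

Section matrices.
Context {R : realType} {n : nat}.
Implicit Types (P : 'M[R]_n) (pi : 'rV[R]_n).

Definition stochastic P : Prop :=
  (forall i j, 0 <= P i j) /\ (forall i, \sum_j P i j = 1).

Definition irreducible P : Prop :=
  forall i j, exists m : nat, 0 < (P ^+ m) i j.

(* The period of every state, i.e. the gcd of its set of return times, is 1. *)
Definition aperiodic P : Prop :=
  forall (i : 'I_n) (g : nat),
    (forall m : nat, (0 < m)%N -> 0 < (P ^+ m) i i -> (g %| m)%N) -> g = 1%N.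

Definition ergodic P : Prop := irreducible P /\ aperiodic P.

Definition stationary P pi : Prop :=
  [/\ forall i, 0 <= pi 0 i, \sum_i pi 0 i = 1 & pi *m P = pi].

Definition stationary_mx pi : 'M[R]_n := \matrix_(i, j) pi 0 j.

Definition fundamental_mx P pi : 'M[R]_n :=
  invmx (1%:M - P + stationary_mx pi).

Definition resistance P pi (i j : 'I_n) : R :=
  let F := fundamental_mx P pi in F i i + F j j - F i j - F j i.

(* [s] lists the complex eigenvalues of [P] other than 1, each one as many
   times as its multiplicity as a root of the characteristic polynomial. *)
Definition nonunit_eigenvalues P (s : seq R[i]) : Prop :=
  forall z : R[i], count_mem z s =
    if z == 1 then 0%N else mup z (char_poly (map_mx (real_complex R) P)).

End matrices.

Section chains.
Context {R : realType} {n : nat} {d : measure_display} {T : measurableType d}.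
Implicit Types (X : nat -> T -> 'I_n) (P : 'M[R]_n).

Definition trajectory X (x : nat -> 'I_n) (m : nat) : set T :=
  [set w | forall k, (k <= m)%N -> X k w = x k].

(* The Markov property
     Pr (X_{m+1} = x_{m+1} | X_0 = x_0, ..., X_m = x_m) = P x_m x_{m+1}
   is multiplied out, so that it is void when the conditioning event is null. *)
Definition markov_chain (Pr : probability T R) X P : Prop :=
  (forall m j, measurable (X m @^-1` [set j])) /\
  (forall x m, Pr (trajectory X x m.+1) =
               (Pr (trajectory X x m) * (P (x m) (x m.+1))%:E)%E).

(* A chain together with its laws: [Pr i] is the law under X_0 = i. *)
Definition markov_family (Pr : 'I_n -> probability T R) X P : Prop :=
  forall i, markov_chain (Pr i) X P /\ Pr i (X 0%N @^-1` [set i]) = 1%E.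

(* Equal to +oo on trajectories that never visit [j]. *)
Definition hitting_time X (j : 'I_n) (w : T) : \bar R :=
  ereal_inf [set m%:R%:E | m in [set m : nat | X m w = j]].

Definition average_hitting_time (Pr : 'I_n -> probability T R) X
    (pi : 'rV[R]_n) : \bar R :=
  (\sum_(i < n) \sum_(j < n)
     (\int[Pr i]_w hitting_time X j w) * (pi 0 i * pi 0 j)%:E)%E.

End chains.

(* Main.v *)
Require Import Defs.
From HB Require Import structures.
From mathcomp Require Import all_boot all_order all_algebra.
From mathcomp Require Import complex.
From mathcomp Require Import all_classical all_reals all_analysis.
From mathcomp Require Import measurable_realfun ring.

Set Implicit Arguments.
Unset Strict Implicit.
Unset Printing Implicit Defensive.

Import Order.TTheory GRing.Theory Num.Theory.
Local Open Scope ring_scope.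

(** Everything rests on one formula for hitting times,
      [pi_j * E_i(tau_j) = F_jj - F_ij],
    where [F = (1 - P + Pi)^-1] satisfies [P F = F - 1 + Pi].

    First-step analysis shows that this formula is plausible:
    [h_i = (F_jj - F_ij) / pi_j] vanishes at [j] and satisfies
    [h_i = 1 + (P h)_i] elsewhere ([mean_hitting_rec]).  To identify [h] with the
    expectation, let [D] be the projection killing the coordinate [j].
    The Markov property gives [Pr_i(tau_j > m) = ((D P)^m D 1)_i]
    ([unvisited_law]), and iterating [h = D 1 + D P h] gives
    [h = sum_(m < N) (D P)^m D 1 + (D P)^N h].  The remainder is bounded by a
    multiple of [Pr_i(tau_j > N)], which tends to [0]: its limit is subharmonic and
    vanishes at [j], hence is zero by the maximum principle
    ([subharmonic_constant]).  Since [E_i(tau_j)] is the sum of the tails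
    [Pr_i(tau_j > m)], it equals [h_i] ([hitting_time_mean]).  The maximum
    principle is also what makes [1 - P + Pi] invertible.

    Rows of [F] sum to [1], so [sum_j pi_j E_i(tau_j) = tr F - 1] for every
    starting state [i] ([random_target]), and the average hitting time is
    [tr F - 1].  Moreover [Omega_ij = pi_i E_j(tau_i) + pi_j E_i(tau_j)]
    ([resistance_commute_time]), so the sum of [Omega] against a symmetric weight
    [c] is [2 sum_ij c_ij pi_j E_i(tau_j)] ([sum_symmetric_resistance]).  Taking
    [c_ij] to be [1], [pi_i pi_j] and [pi_i + pi_j] gives the three indices; in the
    last case the index is [2 (t_av + sum_ij pi_j^2 E_i(tau_j))], and the bounds
    follow from [0 <= pi_j^2 <= pi_j].

    For the spectral expression of [tr F], the commuting matrices [P], [Pi], [F]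
    are triangularized simultaneously over the complex numbers.  [Pi] is idempotent
    of trace [1], so exactly one of its diagonal entries is [1] and the others are
    [0].  At the former position [P] and [F] have diagonal entry [1]; at the others
    [F] has the entry [1 / (1 - l)], where [l] is that of [P]
    ([trace_fundamental_spectrum]). *)

(** * Stochastic matrices and the maximum principle *)

Section Perron.
Context {R : realType} {n : nat}.
Implicit Types (P : 'M[R]_n) (pi : 'rV[R]_n) (v : 'cV[R]_n).

Lemma stochastic_mul P Q : stochastic P -> stochastic Q -> stochastic (P *m Q).
Proof.
move=> [P0 P1] [Q0 Q1]; split=> [i j|i].
  by rewrite mxE sumr_ge0// => k _; rewrite mulr_ge0.
under eq_bigr do rewrite mxE.
rewrite exchange_big -[RHS](P1 i); apply: eq_bigr => k _.
by rewrite -mulr_sumr Q1 mulr1.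
Qed.

Lemma stochastic1 : stochastic (1%:M : 'M[R]_n).
Proof.
split=> [i j|i]; first by rewrite mxE ler0n.
rewrite (bigD1 i)//= big1 ?addr0 ?mxE ?eqxx// => j ji.
by rewrite mxE eq_sym (negPf ji).
Qed.

Lemma stochastic_exp P m : stochastic P -> stochastic (P ^+ m).
Proof.
move=> sP; elim: m => [|m IHm]; first by rewrite expr0; exact: stochastic1.
by rewrite exprS; exact: stochastic_mul.
Qed.

(** Maximum principle.  Iterating [v <= P v] gives [v <= P^m v]; at a state where
    [v] is maximal, [P^m v] averages values that are at most the maximum, so [v]
    is maximal wherever [P^m] puts mass, and by irreducibility some [P^m] puts
    mass on any given state. *)
Lemma subharmonic_constant P v : stochastic P -> irreducible P ->
  (forall i, v i 0 <= (P *m v) i 0) -> forall i j, v i 0 = v j 0.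
Proof.
move=> sP irr vP.
have vPm m i : v i 0 <= (P ^+ m *m v) i 0.
  elim: m i => [|m IHm] i; first by rewrite expr0 mul1mx.
  apply: (le_trans (IHm i)); rewrite exprSr -mulmxA !mxE.
  apply: ler_sum => k _; apply: ler_wpM2l => //.
  by have [] := stochastic_exp m sP.
suff key i0 : (forall k, v k 0 <= v i0 0) -> forall j, v j 0 = v i0 0.
  move=> i j; case: (arg_maxP (fun k => v k 0) (erefl : xpredT i)) => i0 _ max.
  by rewrite (key i0)// ?(key i0 _ j)// => k; exact: max.
move=> max j; have [m Pm_gt0] := irr i0 j.
have [Pm0 Pm1] := stochastic_exp m sP.
(* The average of the nonnegative defects v_i0 - v_k is at most zero. *)
have term_ge0 k : xpredT k -> 0 <= (P ^+ m) i0 k * (v i0 0 - v k 0).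
  by move=> _; rewrite mulr_ge0 ?subr_ge0.
have : \sum_k (P ^+ m) i0 k * (v i0 0 - v k 0) = 0.
  apply/eqP; rewrite eq_le sumr_ge0 ?andbT//.
  under eq_bigr do rewrite mulrBr.
  by rewrite sumrB -mulr_suml Pm1 mul1r subr_le0; have := vPm m i0; rewrite mxE.
move=> /psumr_eq0P /(_ j isT); move=> /(_ term_ge0) /eqP.
by rewrite mulf_eq0 gt_eqF//= subr_eq0 => /eqP.
Qed.

Lemma stationary_exp P pi m : stationary P pi -> pi *m P ^+ m = pi.
Proof.
case=> _ _ piP; elim: m => [|m IHm]; first by rewrite expr0 mulmx1.
by rewrite exprS mulmxA piP.
Qed.

(** If [pi_j = 0] then, as [pi = pi P^m], no state charged by [pi] can reach [j];
    by irreducibility [pi] would vanish identically. *)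
Lemma stationary_gt0 P pi j : stochastic P -> irreducible P ->
  stationary P pi -> 0 < pi 0 j.
Proof.
move=> sP irr piS; have [pi0 pi1 _] := piS.
rewrite lt_def pi0 andbT; apply/eqP => pij0.
suff pi_eq0 i : pi 0 i = 0.
  by move: pi1 => /eqP; rewrite big1 ?(eq_sym 0) ?oner_eq0.
have [m Pm_gt0] := irr i j.
have := congr1 (fun A : 'rV_n => A 0 j) (stationary_exp m piS).
have [Pm0 _] := stochastic_exp m sP.
rewrite mxE pij0 => /psumr_eq0P /(_ i isT).
move=> /(_ (fun k _ => mulr_ge0 (pi0 k) (Pm0 k j))) /eqP.
by rewrite mulf_eq0 orbC gt_eqF//= => /eqP.
Qed.

End Perron.

(** * The fundamental matrix *)

Section Fundamental.
Context {R : realType} {n : nat} (P : 'M[R]_n) (pi : 'rV[R]_n).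
Hypotheses (sP : stochastic P) (irr : irreducible P) (piS : stationary P pi).

Let one : 'cV[R]_n := const_mx 1.
Let Pi := stationary_mx pi.
Let F := fundamental_mx P pi.

Lemma stationary_mxE : Pi = one *m pi.
Proof. by apply/matrixP => i j; rewrite !mxE big_ord1 !mxE mul1r. Qed.

Lemma stochastic_one : P *m one = one.
Proof.
apply/matrixP => i k; rewrite !mxE; case: sP => _ P1; rewrite -[RHS](P1 i).
by apply: eq_bigr => j _; rewrite mxE mulr1.
Qed.

Lemma stationary_one : pi *m one = 1%:M.
Proof.
apply/matrixP => i k; rewrite !ord1 !mxE /=; case: piS => _ <- _.
by apply: eq_bigr => j _; rewrite mxE mulr1.
Qed.

Lemma mul_stationary_mx : P *m Pi = Pi.
Proof. by rewrite stationary_mxE mulmxA stochastic_one. Qed.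

Lemma mul_stationary_mxl : Pi *m P = Pi.
Proof. by case: piS => _ _ piP; rewrite stationary_mxE -mulmxA piP. Qed.

Lemma stationary_mx_idem : Pi *m Pi = Pi.
Proof.
by rewrite stationary_mxE mulmxA -[one *m pi *m one]mulmxA stationary_one mulmx1.
Qed.

(** Multiplying [(1 - P + Pi) v = 0] by [pi] gives [pi v = 0], hence [Pi v = 0] and
    [P v = v]; such a [v] is constant by the maximum principle, and [pi v = 0]
    makes it zero. *)
Lemma fundamental_unit : 1%:M - P + Pi \in unitmx.
Proof.
rewrite -unitmx_tr unitmxE unitfE; apply/det0P => -[w w0 wA0].
set A := 1%:M - P + Pi in wA0.
have {wA0} Av0 : A *m w^T = 0 by rewrite -[A]trmxK -trmx_mul wA0 trmx0.
have piA : pi *m A = pi.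
  have [_ _ piP] := piS.
  by rewrite mulmxDr mulmxBr mulmx1 piP subrr add0r stationary_mxE mulmxA
     stationary_one mul1mx.
have piv0 : pi *m w^T = 0 by rewrite -piA -mulmxA Av0 mulmx0.
have Pv : P *m w^T = w^T.
  move: Av0; rewrite mulmxDl mulmxBl mul1mx stationary_mxE -mulmxA piv0 mulmx0.
  by rewrite addr0 => /eqP; rewrite subr_eq0 => /eqP.
have cst := @subharmonic_constant _ _ P w^T sP irr _.
case/negP: w0; apply/eqP/rowP => i; rewrite [RHS]mxE.
have := congr1 (fun B : 'M[R]_1 => B 0 0) piv0; rewrite !mxE.
under eq_bigr => k _ do rewrite (cst _ k i) ?Pv//.
by case: piS => _ pi1 _; rewrite -mulr_suml pi1 mul1r mxE.
Qed.

Lemma fundamentalV : (1%:M - P + Pi) *m F = 1%:M.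
Proof. exact: (mulmxV fundamental_unit). Qed.

Lemma fundamentalVl : F *m (1%:M - P + Pi) = 1%:M.
Proof. exact: (mulVmx fundamental_unit). Qed.

Lemma fundamental_one : F *m one = one.
Proof.
have Aone : (1%:M - P + Pi) *m one = one.
  by rewrite mulmxDl mulmxBl mul1mx stochastic_one subrr add0r stationary_mxE
     -mulmxA stationary_one mulmx1.
by rewrite -{1}Aone mulmxA fundamentalVl mul1mx.
Qed.

Lemma stationary_fundamental : pi *m F = pi.
Proof.
have piA : pi *m (1%:M - P + Pi) = pi.
  have [_ _ piP] := piS.
  by rewrite mulmxDr mulmxBr mulmx1 piP subrr add0r stationary_mxE mulmxA
     stationary_one mul1mx.
by rewrite -{1}piA -mulmxA fundamentalV mulmx1.
Qed.

Lemma stationary_mx_fundamental : Pi *m F = Pi.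
Proof. by rewrite stationary_mxE -mulmxA stationary_fundamental. Qed.

Lemma fundamental_stationary_mx : F *m Pi = Pi.
Proof. by rewrite stationary_mxE mulmxA fundamental_one. Qed.

Lemma mul_fundamental : P *m F = F - 1%:M + Pi.
Proof.
have := fundamentalV; rewrite mulmxDl mulmxBl mul1mx stationary_mx_fundamental.
by move=> <-; rewrite opprD opprB addrA subrK addrC subrK.
Qed.

Lemma fundamental_comm : F *m P = P *m F.
Proof.
rewrite mul_fundamental; have := fundamentalVl.
rewrite mulmxDr mulmxBr mulmx1 fundamental_stationary_mx.
by move=> <-; rewrite opprD opprB addrA subrK addrC subrK.
Qed.

End Fundamental.

(** * Trace of the fundamental matrix and spectrum *)

Section Spectrum.
Context {C : numClosedFieldType} {n : nat}.
Implicit Types (A B P F : 'M[C]_n).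

Lemma trig_mul_diag A B i : is_trig_mx A -> is_trig_mx B ->
  (A *m B) i i = A i i * B i i.
Proof.
move=> /is_trig_mxP tA /is_trig_mxP tB.
rewrite mxE (bigD1 i)//= big1 ?addr0// => k ki.
have [lt_ik|lt_ki|eq_ik] := ltngtP i k.
- by rewrite tA// mul0r.
- by rewrite tB// mulr0.
- by rewrite (val_inj eq_ik) eqxx in ki.
Qed.

Lemma char_poly_conj V A : V \in unitmx ->
  char_poly (V *m A *m invmx V) = char_poly A.
Proof.
move=> Vu; rewrite /char_poly.
set f := @polyC C.
have -> : char_poly_mx (V *m A *m invmx V)
   = map_mx f V *m char_poly_mx A *m map_mx f (invmx V).
  rewrite /char_poly_mx mulmxBr mulmxBl !map_mxM; congr (_ - _).
  by rewrite scalar_mxC -mulmxA -map_mxM mulmxV// map_mx1 mulmx1.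
rewrite !det_mulmx mulrAC -det_mulmx -map_mxM mulmxV//.
by rewrite map_mx1 det1 mul1r.
Qed.

(** The matrices commute, so they have a common triangular basis, in which the
    relation [(1 - P + Pi) F = 1] can be read off the diagonals. *)
Lemma trace_fundamental_spectrum P Pi F (s : seq C) :
  P *m Pi = Pi -> Pi *m P = Pi -> Pi *m Pi = Pi -> \tr Pi = 1 ->
  F *m P = P *m F -> F *m Pi = Pi *m F -> (1%:M - P + Pi) *m F = 1%:M ->
  (forall z, count_mem z s = if z == 1 then 0%N else mup z (char_poly P)) ->
  size s = n.-1 /\ \tr F = 1 + \sum_(l <- s) 1 / (1 - l).
Proof.
move=> PPi PiP PiPi trPi FP FPi AF sE.
have [|V /unitarymx_unit Vu] := @cotrigonalization C n [:: P; Pi; F].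
  move=> A B; rewrite !inE => /or3P[]/eqP-> /or3P[]/eqP->;
  by rewrite /comm_mx ?PPi ?PiP ?FP ?FPi.
pose J A := V *m A *m invmx V.
move=> /allP trig.
have {}trig A : A \in [:: P; Pi; F] -> is_trig_mx (J A).
  by move=> /trig; rewrite /= /similar_to conjumx.
have JM A B : J (A *m B) = J A *m J B.
  by rewrite /J !mulmxA mulmxKV.
have trJ A : \tr (J A) = \tr A by rewrite mxtrace_mulC mulmxA mulVmx// mul1mx.
have tP : is_trig_mx (J P) by apply: trig; rewrite !inE eqxx.
have tPi : is_trig_mx (J Pi) by apply: trig; rewrite !inE eqxx orbT.
have tF : is_trig_mx (J F) by apply: trig; rewrite !inE eqxx !orbT.
have diagPi i : J Pi i i * J Pi i i = J Pi i i.
  by rewrite -trig_mul_diag// -JM PiPi.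
have diagP i : J P i i * J Pi i i = J Pi i i.
  by rewrite -trig_mul_diag// -JM PPi.
have diagF i : (1 - J P i i + J Pi i i) * J F i i = 1.
  rewrite mulrDl mulrBl mul1r -!trig_mul_diag// -!JM.
  have := congr1 J AF; rewrite mulmxDl mulmxBl mul1mx /J mulmx1 mulmxV//.
  rewrite mulmxDr mulmxBr mulmxDl mulmxBl.
  move=> /(congr1 (fun A : 'M[C]_n => A i i)).
  rewrite ![(_ + _ : 'M[C]_n) i i]mxE ![(- _ : 'M[C]_n) i i]mxE.
  by rewrite ![(1%:M : 'M[C]_n) i i]mxE eqxx.
(* Diagonal entries of Pi are 0 or 1; their sum being 1, just one is nonzero. *)
have diag01 i : J Pi i i = (J Pi i i != 0)%:R.
  have [->|nz] := eqVneq (J Pi i i) 0; first by [].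
  by apply: (mulfI nz); rewrite diagPi mulr1.
have : (\sum_i nat_of_bool (J Pi i i != 0%R))%:R = 1 :> C.
  rewrite natr_sum -[RHS]trPi -trJ; apply: eq_bigr => i _.
  exact/esym/diag01.
move=> /eqP; rewrite (eqr_nat C _ 1) => /eqP sum1.
(* P Pi = Pi puts the eigenvalue 1 of P at the position k0. *)
have [k0 k0nz] : exists k, J Pi k k != 0.
  apply/existsP; apply: contra_eqT sum1; rewrite negb_exists => /forallP z.
  by rewrite big1// => i _; have := z i; rewrite negbK => /eqP ->; rewrite eqxx.
have others i : i != k0 -> J Pi i i = 0.
  move=> ik; apply/eqP; apply: contra_eqT sum1 => nz.
  by rewrite (bigD1 k0)//= (bigD1 i)//= k0nz nz.
have Pk0 : J P k0 k0 = 1 by apply: (mulIf k0nz); rewrite diagP mul1r.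
pose t := [seq J P i i | i <- enum 'I_n & i != k0].
have big_t (T : Type) (idx : T) (op : Monoid.com_law idx) (f : C -> T) :
    \big[op/idx]_(x <- t) f x = \big[op/idx]_(i | i != k0) f (J P i i).
  by rewrite big_map big_filter big_enum_cond.
have cpP : char_poly P = ('X - 1%:P) * \prod_(x <- t) ('X - x%:P).
  by rewrite -(char_poly_conj _ Vu) char_poly_trig// (bigD1 k0)//= Pk0 big_t.
have Fi i : i != k0 -> (1 - J P i i) * J F i i = 1.
  by move=> ik; have := diagF i; rewrite (others i ik) addr0.
have t1 : 1 \notin t.
  apply/mapP => -[k]; rewrite mem_filter => /andP[kk0 _] e.
  by have := Fi k kk0; rewrite -e subrr mul0r => /esym/eqP; rewrite oner_eq0.
have st : perm_eq s t.
  apply/allP => z _ /=; apply/eqP; rewrite sE; have [->|z1] := eqVneq.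
    by rewrite (count_memPn t1).
  rewrite cpP mupMr ?mu_prod_XsubC//.
  by rewrite root_XsubC.
split.
  rewrite (perm_size st) size_map -sum1_size big_filter big_enum_cond /=.
  by rewrite sum1_card cardC1 card_ord.
rewrite -(trJ F) /mxtrace (bigD1 k0)//=; congr (_ + _).
  by have := diagF k0; rewrite Pk0 subrr add0r diag01 k0nz mul1r.
rewrite (perm_big _ st) big_t; apply: eq_bigr => i ik.
have e := Fi i ik.
have nz : 1 - J P i i != 0.
  by apply/eqP => z; move: e; rewrite z mul0r => /esym/eqP; rewrite oner_eq0.
by apply: (mulfI nz); rewrite e div1r divff.
Qed.

End Spectrum.

(** * Survival probabilities and first-step analysis *)

Section Survival.
Import numFieldNormedType.Exports.
Local Open Scope classical_set_scope.
Context {R : realType} {n : nat} (P : 'M[R]_n).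
Implicit Types (i j : 'I_n) (h : 'cV[R]_n).

(** The projection killing the coordinate [j]: [avoid j *m P] is the kernel of the
    chain killed when it leaves [j]. *)
Definition avoid j : 'M[R]_n := diag_mx (\row_k (k != j)%:R).

(** The candidate for the vector of the probabilities [Pr_i(tau_j > m)]; see
    [unvisited_law]. *)
Definition survival j m : 'cV[R]_n :=
  (avoid j *m P) ^+ m *m (avoid j *m const_mx 1).

Lemma avoidE j p (A : 'M[R]_(n, p)) i k :
  (avoid j *m A) i k = (i != j)%:R * A i k.
Proof. by rewrite mul_diag_mx !mxE. Qed.

Lemma survival0 j i : survival j 0 i 0 = (i != j)%:R.
Proof. by rewrite /survival expr0 mul1mx avoidE mxE mulr1. Qed.

Lemma survivalS j m i :
  survival j m.+1 i 0 = (i != j)%:R * (P *m survival j m) i 0.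
Proof. by rewrite /survival exprS -!mulmxA avoidE. Qed.

Hypotheses (sP : stochastic P) (irr : irreducible P).

Lemma survival_ge0 j m i : 0 <= survival j m i 0.
Proof.
elim: m i => [|m IHm] i; first by rewrite survival0 ler0n.
rewrite survivalS mulr_ge0 ?ler0n// mxE sumr_ge0// => k _.
by rewrite mulr_ge0//; case: sP.
Qed.

Lemma survival_decr j m i : survival j m.+1 i 0 <= survival j m i 0.
Proof.
have [P0 P1] := sP.
elim: m i => [|m IHm] i.
  rewrite survivalS survival0 ler_piMr ?ler0n//.
  rewrite mxE -(P1 i); apply: ler_sum => k _.
  by rewrite ler_piMr// survival0 lern1 leq_b1.
rewrite [leLHS]survivalS [leRHS]survivalS ler_wpM2l ?ler0n//.
by rewrite !mxE; apply: ler_sum => k _; rewrite ler_wpM2l.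
Qed.

(** The limit [l] of the decreasing survival vectors satisfies [l = D P l], so
    [l <= P l] and [l] is constant; its value at [j] is zero. *)
Lemma survival_cvg0 j i : (fun m => survival j m i 0) @ \oo --> (0 : R).
Proof.
have cv k : cvgn (fun m => survival j m k 0).
  apply: nonincreasing_is_cvgn.
    by apply/nonincreasing_seqP => m; exact: survival_decr.
  by exists 0 => _ [m _ <-]; exact: survival_ge0.
pose l : 'cV[R]_n := \col_k limn (fun m => survival j m k 0).
have cvl k : (fun m => survival j m k 0) @ \oo --> l k 0 by rewrite mxE.
have l_ge0 k : 0 <= l k 0.
  by rewrite mxE; apply: limr_ge => //; apply: nearW => m; exact: survival_ge0.
have lE k : l k 0 = (k != j)%:R * (P *m l) k 0.
  have shift : (fun m => survival j m.+1 k 0) @ \oo --> l k 0.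
    by move: (cvl k); rewrite -cvg_shiftS.
  rewrite -(cvg_lim (@Rhausdorff R) shift).
  apply: (cvg_lim (@Rhausdorff R)).
  under eq_fun do rewrite survivalS mxE.
  apply: cvgMl_tmp; rewrite mxE.
  apply: cvg_big => [|q _]; first exact: add_continuous.
  exact: cvgMl_tmp.
have lj : l j 0 = 0 by rewrite lE eqxx mul0r.
rewrite -[X in _ --> X]lj.
suff -> : l j 0 = l i 0 by [].
apply: subharmonic_constant sP irr _ _ _ => k.
have Pl_ge0 : 0 <= (P *m l) k 0.
  by rewrite mxE sumr_ge0// => q _; rewrite mulr_ge0//; case: sP.
by rewrite lE ler_piMl// lern1 leq_b1.
Qed.

(** Unfolding the recursion [N] times leaves the remainder [(D P)^N h], dominated
    by a multiple of the survival vector because [h] vanishes at [j].  In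
    particular the recursion has a unique solution. *)
Lemma survival_series j h :
  (forall i, h i 0 = (i != j)%:R * (1 + (P *m h) i 0)) ->
  forall i, (fun N => \sum_(0 <= m < N) survival j m i 0) @ \oo --> h i 0.
Proof.
move=> hE i.
pose rest N := (avoid j *m P) ^+ N *m h.
have hD : h = survival j 0 + avoid j *m P *m h.
  apply/colP => k; rewrite hE [RHS]mxE survival0 -mulmxA avoidE mulrDr mulr1.
  by [].
have hN N : h i 0 = \sum_(0 <= m < N) survival j m i 0 + rest N i 0.
  elim: N => [|N IHN].
    by rewrite big_geq// add0r /rest expr0 mul1mx.
  rewrite big_nat_recr//= [LHS]IHN -addrA; congr (_ + _).
  rewrite /rest {1}hD mulmxDr mulmxA exprSr -mulmxE [LHS]mxE; congr (_ + _).
  by rewrite /survival expr0 mul1mx.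
pose c := \sum_k `|h k 0|.
have le_c k : `|h k 0| <= c * survival j 0 k 0.
  rewrite survival0; have [->|kj] /= := eqVneq k j.
    by rewrite hE eqxx mul0r normr0 mulr0.
  by rewrite mulr1 /c (bigD1 k)//= lerDl sumr_ge0.
have rest_le N k : `|rest N k 0| <= c * survival j N k 0.
  elim: N k => [|N IHN] k; first by rewrite /rest expr0 mul1mx.
  rewrite /rest exprS -!mulmxA avoidE -/(rest N) survivalS mulrCA.
  rewrite normrM ger0_norm ?ler0n// ler_wpM2l ?ler0n// !mxE mulr_sumr.
  apply: (le_trans (ler_norm_sum _ _ _)); apply: ler_sum => q _.
  rewrite normrM mulrCA ger0_norm; last by case: sP.
  by rewrite ler_wpM2l//; case: sP.
have bound0 : (fun N => c * survival j N i 0) @ \oo --> (0 : R).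
  rewrite -[X in _ --> X](mulr0 c).
  by apply: cvgMl_tmp; exact: (survival_cvg0 j i).
have rest0 : (fun N => rest N i 0) @ \oo --> (0 : R).
  apply: (@squeeze_cvgr _ _ _ _ (fun N => - (c * survival j N i 0))
                                 (fun N => c * survival j N i 0)).
  - by apply: nearW => N; rewrite -ler_norml.
  - by rewrite -[X in _ --> X]oppr0; exact: cvgN.
  - by [].
have -> : (fun N => \sum_(0 <= m < N) survival j m i 0)
        = (fun N => h i 0 - rest N i 0).
  by apply/funext => N; rewrite (hN N) addrK.
by rewrite -[X in _ --> X]subr0; apply: cvgB => //; exact: cvg_cst.
Qed.

End Survival.

(** * Hitting times as series of events *)

Section HittingTime.
Local Open Scope classical_set_scope.
Context {R : realType} {n : nat} {d : measure_display} {T : measurableType d}.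
Implicit Types (X : nat -> T -> 'I_n) (P : 'M[R]_n) (Q : probability T R).

(** The event [tau_j > m]. *)
Definition unvisited X j m : set T := [set w | forall k, (k <= m)%N -> X k w <> j].

(** These events interpolate between cylinder sets ([r = 0]), for which the Markov
    property is postulated, and the events [tau_j >= m, X_m = x_m] ([r = m]), for
    which it is needed. *)
Definition tail_trajectory X j r (x : nat -> 'I_n) m : set T :=
  [set w | forall k, if (k < r)%N then X k w <> j else (k <= m)%N -> X k w = x k].

(** A hitting time is the number of times [m] with [tau_j > m]; both sides are
    infinite when [j] is never visited. *)
Lemma hitting_time_series X j w :
  hitting_time X j w = (\sum_(m <oo) (\1_(unvisited X j m) w)%:E)%E :> \bar R.
Proof.
have ge0 k : (0 <= (\1_(unvisited X j k) w : R)%:E)%E by rewrite lee_fin.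
rewrite /hitting_time; have [hit|never] := pselect (exists m, X m w == j).
  have [m /eqP Xm min] := ex_minnP hit.
  transitivity (m%:R%:E : \bar R).
    apply/eqP; rewrite eq_le; apply/andP; split.
      by apply: ereal_inf_lbound; exists m.
    apply: le_ereal_inf_tmp => _ [k /= Xk <-].
    by rewrite lee_fin ler_nat min// Xk.
  rewrite (@nneseries_split _ _ 0 m)//= add0n eseries0 ?adde0; last first.
    move=> k mk _; rewrite indicE memNset//= => /(_ m mk); exact.
  rewrite (eq_big_nat _ _ (F2 := fun _ => 1%E)).
    by rewrite sumEFin big_const_nat subn0 iter_addr addr0.
  move=> k /andP[_ km]; rewrite indicE mem_set//= => q qk Xq.
  by have := min q; rewrite Xq eqxx leqNgt (leq_ltn_trans qk km) => /(_ isT).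
rewrite (_ : [set m | X m w = j] = set0); last first.
  by apply/seteqP; split=> // m /= Xm; case: never; exists m; rewrite Xm.
rewrite image_set0 ereal_inf0; apply/esym/eqyP => A A0.
have [N AN] : exists N : nat, A <= N%:R.
  exists (Num.bound A); apply: ltW; exact: archi_boundP (ltW A0).
apply: (le_trans _ (@nneseries_lim_ge _ _ xpredT 0 N _)) => //.
rewrite (eq_big_nat _ _ (F2 := fun _ => 1%E)).
  by rewrite sumEFin big_const_nat subn0 iter_addr addr0 lee_fin.
move=> k _; rewrite indicE mem_set//= => q _ Xq.
by case: never; exists q; rewrite Xq.
Qed.

Section Law.
Variables (X : nat -> T -> 'I_n).
Hypothesis mX : forall m j, measurable (X m @^-1` [set j]).

Lemma unvisited_measurable j m : measurable (unvisited X j m).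
Proof.
rewrite (_ : unvisited X j m =
  \bigcap_k (if (k <= m)%N then ~` (X k @^-1` [set j]) else setT)).
  by apply: bigcapT_measurable => k; case: ifP => _ //; exact: measurableC.
apply/seteqP; split=> [w /= Xw k _|w Xw k km] /=.
  by case: ifP => // km; exact: Xw.
by have /= := Xw k I; rewrite km.
Qed.

Lemma tail_trajectory_measurable j r x m : measurable (tail_trajectory X j r x m).
Proof.
rewrite (_ : tail_trajectory X j r x m =
  \bigcap_k (if (k < r)%N then ~` (X k @^-1` [set j]) else
             if (k <= m)%N then X k @^-1` [set x k] else setT)).
  by apply: bigcapT_measurable => k; do 2?case: ifP => _ //; exact: measurableC.
apply/seteqP; split=> [w /= Xw k _|w Xw k] /=.
  by have := Xw k; do 2?case: ifP => // _; apply.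
by have /= := Xw k I; do 2?case: ifP => // _.
Qed.

Lemma total_probability Q r (A : set T) : measurable A ->
  Q A = (\sum_(v < n) Q (A `&` X r @^-1` [set v]))%E.
Proof.
move=> mA; have mAX v : measurable (A `&` X r @^-1` [set v]) by exact: measurableI.
rewrite -measure_semi_additive_ord//.
- congr (Q _); apply/seteqP; split=> w.
    by move=> Aw; rewrite -bigcup_seq; exists (X r w) => //=; rewrite mem_index_enum.
  by rewrite -bigcup_seq => -[v _ []].
- apply/trivIsetP => u v _ _ uv; apply/seteqP; split=> w //= -[[_ Xu] [_ Xv]].
  by rewrite -Xu -Xv eqxx in uv.
- exact: bigsetU_measurable.
Qed.

End Law.
End HittingTime.

(** * Hitting times of a Markov chain *)

Section MarkovLaw.
Local Open Scope classical_set_scope.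
Context {R : realType} {n : nat} {d : measure_display} {T : measurableType d}.
Variables (P : 'M[R]_n) (Q : probability T R) (X : nat -> T -> 'I_n).
Hypothesis XP : markov_chain Q X P.

Let mX : forall m j, measurable (X m @^-1` [set j]) := XP.1.

Lemma tail_trajectory_cond j r x m v : (r <= m)%N ->
  tail_trajectory X j r.+1 x m `&` X r @^-1` [set v] =
  if v == j then set0
  else tail_trajectory X j r (fun k => if k == r then v else x k) m.
Proof.
move=> rm; have [->|vj] := eqVneq v j.
  by apply/seteqP; split=> w //= [/(_ r)]; rewrite ltnS leqnn.
apply/seteqP; split=> w /=.
  move=> [Xw Xr] k; have := Xw k; have [->|kr] := eqVneq k r.
    by rewrite ltnn.
  by rewrite ltnS [(k <= r)%N]leq_eqVlt (negPf kr).
move=> Xw; have Xr : X r w = v by have := Xw r; rewrite ltnn eqxx; apply.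
split=> // k; have := Xw k; have [->|kr] := eqVneq k r.
  by move=> _; rewrite ltnSn Xr; apply/eqP.
by rewrite ltnS [(k <= r)%N]leq_eqVlt (negPf kr).
Qed.

(** Conditioning on [X_r] reduces [r.+1] to [r] without altering the last two
    coordinates, as long as [r < m]; hence the restriction [r <= m]. *)
Lemma markov_tail j r x m : (r <= m)%N ->
  Q (tail_trajectory X j r x m.+1) =
  (Q (tail_trajectory X j r x m) * (P (x m) (x m.+1))%:E)%E.
Proof.
elim: r x => [|r IHr] x rm.
  have E k : tail_trajectory X j 0 x k = trajectory X x k by [].
  by rewrite !E; exact: XP.2.
rewrite (total_probability mX Q r (tail_trajectory_measurable mX _ _ _ _)).
rewrite (total_probability mX Q r (tail_trajectory_measurable mX j r.+1 x m)).
rewrite ge0_sume_distrl//; apply: eq_bigr => v _.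
rewrite !tail_trajectory_cond; [|exact: ltnW|exact: leqW (ltnW rm)].
case: ifP => _; first by rewrite measure0 mul0e.
by rewrite IHr ?(ltnW rm)// !gtn_eqF// ltnS ltnW.
Qed.

Lemma tail_trajectory_last j m x y : x m = y m ->
  tail_trajectory X j m x m = tail_trajectory X j m y m.
Proof.
move=> xy; apply/seteqP; split=> w /= Xw k; have := Xw k;
  by case: ltngtP => // ->; rewrite xy.
Qed.

Lemma tail_trajectory_last_step j m k v :
  Q (tail_trajectory X j m.+1 (fun=> k) m.+1 `&` X m @^-1` [set v]) =
  (Q (tail_trajectory X j m (fun=> v) m) * ((v != j)%:R * P v k)%:E)%E.
Proof.
rewrite tail_trajectory_cond//; case: ifP => vj.
  by rewrite measure0 mul0r mule0.
by rewrite markov_tail// eqxx gtn_eqF// mul1r; congr (Q _ * _)%E;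
  apply: tail_trajectory_last; rewrite eqxx.
Qed.

(** The law of the chain killed when it leaves [j]: a step from [X_m = v] survives
    only if [v != j], which is the factor [avoid j] in front of [P]. *)
Lemma first_passage_law i j m k : Q (X 0%N @^-1` [set i]) = 1%E ->
  Q (tail_trajectory X j m (fun=> k) m) = (((avoid j *m P) ^+ m) i k)%:E.
Proof.
move=> Q0; elim: m k => [|m IHm] k.
  have -> : tail_trajectory X j 0 (fun=> k) 0 = X 0%N @^-1` [set k].
    apply/seteqP; split=> w /=; first by move=> /(_ 0%N); exact.
    by move=> Xw q; rewrite ltn0 leqn0 => /eqP ->.
  rewrite expr0 mxE; have [<-//|ik] := eqVneq i k.
  apply/eqP; rewrite -measure_le0.
  have <- : Q (~` (X 0%N @^-1` [set i])) = 0%E.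
    by rewrite probability_setC// Q0 subee.
  apply: le_measure; rewrite ?inE//; first exact: measurableC.
  by move=> w /= -> ki; rewrite ki eqxx in ik.
rewrite (total_probability mX Q m (tail_trajectory_measurable mX _ _ _ _)).
under eq_bigr do rewrite tail_trajectory_last_step IHm -EFinM.
rewrite sumEFin exprSr -mulmxE [in RHS]mxE; congr (_%:E).
by apply: eq_bigr => v _; rewrite avoidE.
Qed.

Lemma unvisited_law i j m : Q (X 0%N @^-1` [set i]) = 1%E ->
  Q (unvisited X j m) = (survival P j m i 0)%:E.
Proof.
move=> Q0; rewrite (total_probability mX Q m (unvisited_measurable mX _ _)).
rewrite /survival mxE -sumEFin; apply: eq_bigr => k _.
rewrite avoidE mxE mulr1 EFinM -first_passage_law//.
have [->|kj] := eqVneq k j.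
  rewrite mule0 -[RHS](measure0 Q); congr (Q _).
  by apply/seteqP; split=> w //= [Xw Xm]; case: (Xw m).
rewrite mule1; congr (Q _); apply/seteqP; split=> w /=.
  move=> [Xw Xm] q; have [qm|mq] := ltnP q m; first exact/Xw/ltnW.
  by move=> qm; rewrite -Xm (anti_leq (introT andP (conj qm mq))).
move=> Xw; have Xm : X m w = k by have := Xw m; rewrite ltnn; apply.
split=> // q; rewrite leq_eqVlt => /predU1P[->|qm].
  by rewrite Xm; apply/eqP.
by have := Xw q; rewrite qm.
Qed.

(** The integral of the series of indicators is the series of the survival
    probabilities, which sums to the solution of the first-step equations. *)
Lemma hitting_time_mean i j (h : 'cV[R]_n) :
  stochastic P -> irreducible P -> Q (X 0%N @^-1` [set i]) = 1%E ->
  (forall k, h k 0 = (k != j)%:R * (1 + (P *m h) k 0)) ->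
  (\int[Q]_w hitting_time X j w = (h i 0)%:E)%E.
Proof.
move=> sP irr Q0 hE.
under eq_integral do rewrite hitting_time_series.
rewrite integral_nneseries//; last first.
  move=> m; apply/measurable_EFinP; apply: measurable_indic.
  exact: unvisited_measurable.
rewrite (eq_eseriesr (g := fun m => (survival P j m i 0)%:E)); last first.
  move=> m _; rewrite integral_indic ?setIT//; last exact: unvisited_measurable.
  exact: unvisited_law.
apply: cvg_lim => //.
under eq_fun do rewrite sumEFin.
apply: cvg_EFin; first exact: nearW.
exact: survival_series.
Qed.

End MarkovLaw.

(** * Kirchhoff indices *)

Section MeanHittingTimes.
Import numFieldNormedType.Exports.
Context {R : realType} {n : nat} (P : 'M[R]_n) (pi : 'rV[R]_n).
Hypotheses (sP : stochastic P) (irr : irreducible P) (piS : stationary P pi).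

Let F := fundamental_mx P pi.

Definition mean_hitting j : 'cV[R]_n := \col_i ((F j j - F i j) / pi 0 j).

(** First-step equations, from [P F = F - 1 + Pi]: off the diagonal,
    [(P F)_ij = F_ij + pi_j]. *)
Lemma mean_hitting_rec j i :
  mean_hitting j i 0 = (i != j)%:R * (1 + (P *m mean_hitting j) i 0).
Proof.
have [->|ij] /= := eqVneq i j; first by rewrite mul0r mxE subrr mul0r.
have pij : pi 0 j != 0 by rewrite gt_eqF// (stationary_gt0 j sP irr).
have [_ P1] := sP.
have PF : \sum_k P i k * F k j = F i j + pi 0 j.
  have := congr1 (fun A : 'M[R]_n => A i j) (mul_fundamental sP irr piS).
  by rewrite !mxE (negPf ij) subr0.
have -> : (P *m mean_hitting j) i 0 = (F j j - (F i j + pi 0 j)) / pi 0 j.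
  rewrite -PF mxE -{1}[F j j]mul1r -(P1 i) mulr_suml -sumrB mulr_suml.
  by apply: eq_bigr => k _; rewrite mxE mulrA mulrBr.
by rewrite mul1r mxE; field.
Qed.

Lemma mean_hitting_ge0 j i : 0 <= mean_hitting j i 0.
Proof.
have cv := survival_series sP irr (@mean_hitting_rec j) (i := i).
rewrite -(cvg_lim (@Rhausdorff R) cv); apply: limr_ge; first exact: cvgP cv.
by apply: nearW => N; apply: sumr_ge0 => m _; exact: survival_ge0.
Qed.

Lemma pi_mean_hitting j i : pi 0 j * mean_hitting j i 0 = F j j - F i j.
Proof.
by rewrite mxE mulrC divfK// gt_eqF// (stationary_gt0 j sP irr).
Qed.

Lemma fundamental_row i : \sum_j F i j = 1.
Proof.
have := congr1 (fun A : 'cV[R]_n => A i 0) (fundamental_one sP irr piS).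
by rewrite !mxE => <-; apply: eq_bigr => j _; rewrite mxE mulr1.
Qed.

Lemma fundamental_col j : \sum_i pi 0 i * F i j = pi 0 j.
Proof.
have := congr1 (fun A : 'rV[R]_n => A 0 j) (stationary_fundamental sP irr piS).
by rewrite mxE.
Qed.

(** Random target lemma: the expected time to reach a state drawn from [pi] does
    not depend on the starting state. *)
Lemma random_target i : \sum_j pi 0 j * mean_hitting j i 0 = \tr F - 1.
Proof.
by under eq_bigr do rewrite pi_mean_hitting; rewrite sumrB fundamental_row.
Qed.

Lemma resistance_commute_time i j :
  resistance P pi i j =
  pi 0 i * mean_hitting i j 0 + pi 0 j * mean_hitting j i 0.
Proof. by rewrite !pi_mean_hitting /resistance -/F; ring. Qed.

(** The two halves of the commute time are exchanged by swapping [i] and [j]. *)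
Lemma sum_symmetric_resistance (c : 'I_n -> 'I_n -> R) :
  (forall i j, c i j = c j i) ->
  \sum_i \sum_j c i j * resistance P pi i j =
  2 * \sum_i \sum_j c i j * (pi 0 j * mean_hitting j i 0).
Proof.
move=> cC; under eq_bigr do under eq_bigr do
  rewrite resistance_commute_time mulrDr.
under eq_bigr do rewrite big_split /=.
rewrite big_split /= exchange_big /= mulr_natl mulr2n; congr (_ + _).
by apply: eq_bigr => i _; apply: eq_bigr => j _; rewrite cC.
Qed.

Lemma sum_resistance : \sum_i \sum_j resistance P pi i j = 2 * n%:R * (\tr F - 1).
Proof.
have := @sum_symmetric_resistance (fun _ _ => 1) (fun _ _ => erefl).
under eq_bigr do under eq_bigr do rewrite mul1r.
move=> ->; rewrite -mulrA; congr (_ * _).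
under eq_bigr do (under eq_bigr do rewrite mul1r; rewrite random_target).
by rewrite sumr_const card_ord mulr_natl.
Qed.

Lemma sum_weighted_resistance :
  \sum_i \sum_j pi 0 i * pi 0 j * resistance P pi i j =
  2 * \tr (diag_mx pi *m F - diag_mx pi *m stationary_mx pi).
Proof.
have [_ pi1 _] := piS.
rewrite (@sum_symmetric_resistance (fun i j => pi 0 i * pi 0 j)); last first.
  by move=> i j; rewrite mulrC.
congr (_ * _); rewrite exchange_big /mxtrace /=; apply: eq_bigr => j _.
rewrite !mul_diag_mx !mxE -mulrBr.
transitivity (pi 0 j * \sum_i pi 0 i * (F j j - F i j)).
  rewrite mulr_sumr; apply: eq_bigr => i _.
  by rewrite pi_mean_hitting mulrCA mulrA.
under eq_bigr do rewrite mulrBr.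
by rewrite sumrB -mulr_suml pi1 mul1r fundamental_col.
Qed.

(** The part of the weight carried by the starting state contributes
    [tr F - 1] by the random target lemma; the other part is a remainder, which
    the next two lemmas bound using [0 <= pi_j <= 1]. *)
Lemma sum_additive_resistance :
  \sum_i \sum_j (pi 0 i + pi 0 j) * resistance P pi i j =
  2 * (\tr F - 1 + \sum_i \sum_j pi 0 j * (pi 0 j * mean_hitting j i 0)).
Proof.
have [_ pi1 _] := piS.
rewrite (@sum_symmetric_resistance (fun i j => pi 0 i + pi 0 j)); last first.
  by move=> i j; rewrite addrC.
congr (_ * _).
under eq_bigr do under eq_bigr do rewrite mulrDl.
under eq_bigr do rewrite big_split /= -mulr_sumr random_target.
by rewrite big_split /= -mulr_suml pi1 mul1r.
Qed.

Lemma sum_additive_resistance_ge :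
  2 * (\tr F - 1) <= \sum_i \sum_j (pi 0 i + pi 0 j) * resistance P pi i j.
Proof.
have [pi0 _ _] := piS.
rewrite sum_additive_resistance ler_wpM2l// lerDl.
by do 2!apply: sumr_ge0 => ? _; rewrite !mulr_ge0// mean_hitting_ge0.
Qed.

Lemma sum_additive_resistance_le :
  \sum_i \sum_j (pi 0 i + pi 0 j) * resistance P pi i j
    <= 2 * (\tr F - 1) * (n%:R + 1).
Proof.
have [pi0 pi1 _] := piS.
rewrite sum_additive_resistance -mulrA ler_wpM2l// mulrDr mulr1 addrC lerD2r.
rewrite mulr_natr -[X in _ *+ X]card_ord -sumr_const; apply: ler_sum => i _.
rewrite -(random_target i); apply: ler_sum => j _.
rewrite ler_piMl ?mulr_ge0 ?mean_hitting_ge0//.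
by rewrite -pi1 (bigD1 j)//= lerDl sumr_ge0.
Qed.

End MeanHittingTimes.

Lemma average_hitting_timeE (R : realType) (n : nat) (d : measure_display)
    (T : measurableType d) (P : 'M[R]_n) (pi : 'rV[R]_n)
    (Pr : 'I_n -> probability T R) (X : nat -> T -> 'I_n) :
  stochastic P -> irreducible P -> stationary P pi -> markov_family Pr X P ->
  average_hitting_time Pr X pi = (\tr (fundamental_mx P pi) - 1)%:E.
Proof.
move=> sP irr piS XP; have [_ pi1 _] := piS.
rewrite /average_hitting_time.
under eq_bigr => i _.
  under eq_bigr => j _.
    rewrite (hitting_time_mean (XP i).1 sP irr (XP i).2
      (mean_hitting_rec sP irr piS j)) -EFinM mulrC -mulrA.
    over.
  rewrite sumEFin -mulr_sumr random_target//.
  over.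
by rewrite sumEFin -mulr_suml pi1 mul1r.
Qed.

Lemma trace_fundamental_eigenvalues (R : realType) (n : nat)
    (P : 'M[R]_n) (pi : 'rV[R]_n) (lambda : seq R[i]) :
  stochastic P -> irreducible P -> stationary P pi ->
  nonunit_eigenvalues P lambda ->
  size lambda = n.-1 /\
  (\tr (fundamental_mx P pi) - 1)%:C%C = \sum_(l <- lambda) 1 / (1 - l).
Proof.
move=> sP irr piS lE.
pose c := real_complex R.
have [||||||| |sz tr] := @trace_fundamental_spectrum _ _ (map_mx c P)
  (map_mx c (stationary_mx pi)) (map_mx c (fundamental_mx P pi)) lambda.
- by rewrite -map_mxM mul_stationary_mx.
- by rewrite -map_mxM mul_stationary_mxl.
- by rewrite -map_mxM (stationary_mx_idem piS).
- rewrite trace_map_mx stationary_mxE mxtrace_mulC (stationary_one piS).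
  by rewrite mxtrace1 rmorph1.
- by rewrite -!map_mxM fundamental_comm.
- by rewrite -!map_mxM fundamental_stationary_mx// stationary_mx_fundamental.
- by rewrite -(map_mx1 c) -map_mxB -map_mxD -map_mxM fundamentalV.
- exact: lE.
split=> //.
have -> : (\tr (fundamental_mx P pi) - 1)%:C%C = c (\tr (fundamental_mx P pi)) - 1.
  by rewrite rmorphB rmorph1.
by move: tr; rewrite trace_map_mx /c /= => ->; rewrite addrC addKr.
Qed.

Theorem corollary1p1 (R : realType) (n : nat)
  (d : measure_display) (T : measurableType d)
  (P : 'M[R]_n) (pi : 'rV[R]_n)
  (Pr : 'I_n -> probability T R) (X : nat -> T -> 'I_n)
  (lambda : seq R[i])
  (P_stochastic : stochastic P)
  (P_ergodic : ergodic P)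
  (pi_stationary : stationary P pi)
  (X_markov : markov_family Pr X P)
  (lambda_eigen : nonunit_eigenvalues P lambda) :
  let F := fundamental_mx P pi in
  let Pi := stationary_mx pi in
  let M := diag_mx pi in
  let Omega := resistance P pi in
  let t_av := average_hitting_time Pr X pi in
  [/\ [/\ (\sum_i \sum_j Omega i j)%:E = ((2 * n%:R)%:E * t_av)%E,
          size lambda = n.-1
        & (fine ((2 * n%:R)%:E * t_av))%:C%C =
          2 * n%:R * \sum_(l <- lambda) 1 / (1 - l)],
      \sum_i \sum_j pi 0 i * pi 0 j * Omega i j
        = 2 * \tr (M *m F - M *m Pi),
      (2%:E * t_av <= (\sum_i \sum_j (pi 0 i + pi 0 j) * Omega i j)%:E)%E
    & ((\sum_i \sum_j (pi 0 i + pi 0 j) * Omega i j)%:E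
         <= 2%:E * t_av * (n%:R + 1)%:E)%E].

Proof.
have [irr _] := P_ergodic.
move=> F Pi M Omega t_av.
have tE : t_av = (\tr F - 1)%:E by exact: average_hitting_timeE.
have [sz trF] := trace_fundamental_eigenvalues P_stochastic irr pi_stationary
  lambda_eigen.
split; first split.
- by rewrite tE -EFinM sum_resistance.
- exact: sz.
- have natC : (2 * n%:R : R)%:C%C = 2 * n%:R by rewrite rmorphM !rmorph_nat.
  by rewrite tE -EFinM /= -natC -trF; exact: rmorphM.
- exact: sum_weighted_resistance.
- by rewrite tE -EFinM lee_fin sum_additive_resistance_ge.
- by rewrite tE -!EFinM lee_fin sum_additive_resistance_le.
Qed.
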